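(* Let $\mathbb{F}\in\{\mathbb{R},\mathbb{C}\}$, $q\ge2$, let $\mathscr{O}=\{O_i\}_{i=1}^n$ be a complete design of self-adjoint $q\times q$ matrices over $\mathbb{F}$, and let $K:\mathbb{R}\times\mathbb{R}\to\mathbb{F}$ be a reproducing kernel. If the squared kernel $|K|^2:\mathbb{R}\times\mathbb{R}\to\mathbb{R}$ is strictly positive definite, then the kernel Gram superoperator $\mathfrak{H}_K$ is strictly positive definite, and the QUARK estimator, i.e. the minimizer of $\mathrm{Loss}_K[S]$ over trace-one $S\in\mathbb{F}^{q\times q}_{sa}$, is uniquely given by $$\hat\rho^{K}=\mathfrak{H}_K^{-1}(P_K)+\big(1-\mathrm{Tr}[\mathfrak{H}_K^{-1}(P_K)]\big)\frac{\mathfrak{H}_K^{-1}(I_q)}{\mathrm{Tr}[\mathfrak{H}_K^{-1}(I_q)]}.$$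
   Context: $\mathbb{F}^{q\times q}_{sa}$ is the real vector space of self-adjoint (symmetric/Hermitian) $q\times q$ matrices with Frobenius inner product. Each $O_i=\sum_{k=1}^{q_i}\lambda_{ik}\Pi_{ik}$ with distinct real eigenvalues, orthogonal eigenprojections $\Pi_{ik}$, multiplicities $m_{ik}=\mathrm{Tr}[\Pi_{ik}]$, $q_i\ge2$; $d_{ik}[S]=\mathrm{Tr}[S\Pi_{ik}]$. $\mathscr{O}$ is a complete design if for every traceless $\Delta\in\mathbb{F}^{q\times q}_{sa}$: $d_{ik}[\Delta]=0$ for all $i,k$ if and only if $\Delta=0$. For each $i$ there are outcomes $Y_{i1},\dots,Y_{ir}\in\{\lambda_{i1},\dots,\lambda_{iq_i}\}$ and $p_{ik}=\#\{j:Y_{ij}=\lambda_{ik}\}/r$. A reproducing kernel is a function whose finite Gram matrices are non-negative definite, with reproducing kernel Hilbert space $\mathcal{R}(K)$, $k_x=K(\cdot,x)$, and $k_xk_x^*f=\langle f,k_x\rangle k_x$. $|K|^2$ is strictly positive definite if $[|K(x_a,x_b)|^2]_{a,b}$ is a positive definite matrix for any finitely many distinct points $x_a\in\mathbb{R}$. The loss is $$\mathrm{Loss}_K[S]=\sum_{i=1}^n\Big\|\sum_{k=1}^{q_i}(d_{ik}[S]-p_{ik})\,k_{\lambda_{ik}}k_{\lambda_{ik}}^*\Big\|_2^2,$$ with $\|\cdot\|_2$ the Hilbert–Schmidt norm on $\mathcal{R}(K)$. With $[\Omega_i]_{kk'}=|K(\lambda_{ik},\lambda_{ik'})|^2$,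 the kernel Gram superoperator and effective data matrix are $$\mathfrak{H}_K:\mathbb{F}^{q\times q}_{sa}\to\mathbb{F}^{q\times q}_{sa},\ S\mapsto\frac1n\sum_{i=1}^n\sum_{k,k'=1}^{q_i}[\Omega_i]_{kk'}\mathrm{Tr}[S\Pi_{ik}]\Pi_{ik'},\qquad P_K=\frac1n\sum_{i=1}^n\sum_{k,k'=1}^{q_i}[\Omega_i]_{kk'}p_{ik}\Pi_{ik'}.$$ *)

(* Defs.v *)
From HB Require Import structures.
From mathcomp Require Import all_boot all_order all_algebra.
From mathcomp Require Import all_classical all_reals all_analysis.
From mathcomp Require Import complex.

Set Implicit Arguments.
Unset Strict Implicit.
Unset Printing Implicit Defensive.

Import Order.TTheory GRing.Theory Num.Theory numFieldNormedType.Exports.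

Local Open Scope classical_set_scope.
Local Open Scope ring_scope.

Variant scalar_kind := RealScalars | ComplexScalars.

Definition scalars (R : realType) (c : scalar_kind) : numFieldType :=
  match c with RealScalars => R | ComplexScalars => complex R end.

Definition sconj (R : realType) (c : scalar_kind) :
    {rmorphism scalars R c -> scalars R c} :=
  match c return {rmorphism scalars R c -> scalars R c} with
  | RealScalars => idfun
  | ComplexScalars => @conjc R
  end.

Definition of_real (R : realType) (c : scalar_kind) :
    {rmorphism R -> scalars R c} :=
  match c return {rmorphism R -> scalars R c} with
  | RealScalars => idfun
  | ComplexScalars => real_complex R
  end.

Definition real_part (R : realType) (c : scalar_kind) : scalars R c -> R :=
  match c return scalars R c -> R with
  | RealScalars => id
  | ComplexScalars => @complex.Re R
  end.

Arguments sconj {R c}.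
Arguments of_real {R c}.
Arguments real_part {R c}.

(* The norm of [scalars R c] takes its (real) values in [scalars R c]. *)
Definition sqnorm (R : realType) (c : scalar_kind) (z : scalars R c) : R :=
  real_part (`|z| ^+ 2).

Section Matrices.
Context {R : realType} {c : scalar_kind}.
Local Notation F := (scalars R c).

Definition adjmx (m p : nat) (A : 'M[F]_(m, p)) : 'M[F]_(p, m) :=
  map_mx sconj A^T.

Definition selfadj (q : nat) : set 'M[F]_q := [set A | adjmx A = A].

Definition frobenius (q : nat) (A B : 'M[F]_q) : R :=
  real_part (\tr (A *m adjmx B)).

(* In the partial order of [F], [0 <= z] entails that [z] is real. *)
Definition nonneg_definite (m : nat) (A : 'M[F]_m) : Prop :=
  selfadj A /\ forall v : 'cV[F]_m, 0 <= (adjmx v *m A *m v) 0 0.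

Definition reproducing_kernel (K : R -> R -> F) : Prop :=
  forall (m : nat) (x : 'I_m -> R),
    nonneg_definite (\matrix_(a, b) K (x a) (x b)).

(* Strict positive definiteness of a superoperator, seen as a real-linear
   endomorphism of the Euclidean space of self-adjoint matrices. *)
Definition superoperator (q : nat) (T : 'M[F]_q -> 'M[F]_q) : Prop :=
  (forall A, selfadj A -> selfadj (T A)) /\
  (forall (a : R) A B, selfadj A -> selfadj B ->
     T (of_real a *: A + B) = of_real a *: T A + T B).

Definition strictly_positive_superoperator (q : nat)
    (T : 'M[F]_q -> 'M[F]_q) : Prop :=
  [/\ superoperator T,
      (forall A B, selfadj A -> selfadj B ->
         frobenius (T A) B = frobenius A (T B))
    & (forall A, selfadj A -> A != 0 -> 0 < frobenius (T A) A)].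

(* Inverse of [T] as a map from self-adjoint matrices to self-adjoint
   matrices; the value 0 is taken outside of the image of [T]. *)
Definition superop_inv (q : nat) (T : 'M[F]_q -> 'M[F]_q) :
    'M[F]_q -> 'M[F]_q :=
  'pinv_(fun=> 0) (@selfadj q) T.

End Matrices.

Definition positive_definite (R : realType) (m : nat) (A : 'M[R]_m) : Prop :=
  A^T = A /\ forall v : 'cV[R]_m, v != 0 -> 0 < (v^T *m A *m v) 0 0.

Definition strictly_positive_definite_kernel (R : realType)
    (L : R -> R -> R) : Prop :=
  forall (m : nat) (x : 'I_m -> R), injective x ->
    positive_definite (\matrix_(a, b) L (x a) (x b)).

Definition sqkernel (R : realType) (c : scalar_kind)
    (K : R -> R -> scalars R c) (x y : R) : R := sqnorm (K x y).

(* A self-adjoint matrix together with its spectral decomposition (which it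
   determines up to the numbering of the eigenvalues). *)
Record observable (R : realType) (c : scalar_kind) (q : nat) := Observable {
  obs_mx :> 'M[scalars R c]_q;
  nval : nat;
  eigval : 'I_nval -> R;
  eigproj : 'I_nval -> 'M[scalars R c]_q;
  nval_ge2 : (2 <= nval)%N;
  eigval_inj : injective eigval;
  eigproj_neq0 : forall k, eigproj k != 0;
  eigproj_selfadj : forall k, selfadj (eigproj k);
  eigprojM : forall k l, eigproj k *m eigproj l = eigproj k *+ (k == l);
  eigproj_sum : \sum_k eigproj k = 1%:M;
  obs_spectral : obs_mx = \sum_k of_real (eigval k) *: eigproj k
}.

Section Design.
Context {R : realType} {c : scalar_kind} {q n r : nat}.
Local Notation F := (scalars R c).
Implicit Types (A : observable R c q) (O : 'I_n -> observable R c q).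

Definition dcoef A (k : 'I_(nval A)) (S : 'M[F]_q) : F :=
  \tr (S *m eigproj k).

Definition complete_design O : Prop :=
  forall D : 'M[F]_q, selfadj D -> \tr D = 0 ->
    (forall i (k : 'I_(nval (O i))), dcoef k D = 0) <-> D = 0.

Definition outcomes_of A (Y : 'I_r -> R) : Prop :=
  forall j, exists k : 'I_(nval A), Y j = eigval k.

Definition freq A (Y : 'I_r -> R) (k : 'I_(nval A)) : R :=
  #|[pred j | Y j == eigval k]|%:R / r%:R.

Definition kernel_gram (K : R -> R -> F) O (S : 'M[F]_q) : 'M[F]_q :=
  n%:R^-1 *: \sum_(i < n) \sum_(k < nval (O i)) \sum_(l < nval (O i))
    (of_real (sqkernel K (eigval k) (eigval l)) * \tr (S *m eigproj k))
      *: eigproj l.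

Definition effective_data (K : R -> R -> F) O (Y : 'I_n -> 'I_r -> R) :
    'M[F]_q :=
  n%:R^-1 *: \sum_(i < n) \sum_(k < nval (O i)) \sum_(l < nval (O i))
    of_real (sqkernel K (eigval k) (eigval l) * freq (Y i) k) *: eigproj l.

End Design.

(* A reproducing kernel Hilbert space with kernel [K]: a Hilbert space, with
   inner product linear in the first argument, whose elements are identified
   with functions through the injection [rk_fun].  By the Moore-Aronszajn
   theorem it exists and is unique up to isometry. *)
Record rkhs (R : realType) (c : scalar_kind) (K : R -> R -> scalars R c) :=
  Rkhs {
  rk_space :> completeNormedModType (scalars R c);
  rk_ip : {dot rk_space for (@sconj R c)};
  rk_norm : forall f : rk_space, `|f| ^+ 2 = rk_ip f f;
  rk_fun : {linear rk_space -> (R -> (scalars R c)^o)};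
  rk_fun_inj : injective rk_fun;
  rk_kx : R -> rk_space;
  rk_kxE : forall x, rk_fun (rk_kx x) = K ^~ x;
  rk_reproducing : forall f x, rk_fun f x = rk_ip f (rk_kx x)
}.

Section HilbertSchmidt.
Context {R : realType} {c : scalar_kind} {K : R -> R -> scalars R c}.
Local Notation F := (scalars R c).
Variable H : rkhs K.

Definition linear_span (E : set H) : set H :=
  [set f | exists (m : nat) (e : 'I_m -> H) (a : 'I_m -> F),
     (forall j, E (e j)) /\ f = \sum_j a j *: e j].

Definition orthonormal_basis (E : set H) : Prop :=
  (forall e f, E e -> E f -> rk_ip H e f = (e == f)%:R) /\
  closure (linear_span E) = setT.

(* Squared Hilbert-Schmidt norm; its value is the same for all orthonormal
   bases [E]. *)
Definition hs_sqnorm (E : set H) (T : H -> H) : \bar R :=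
  (\esum_(e in E) (real_part (`|T e| ^+ 2))%:E)%E.

(* The operator $k_x k_x^*$. *)
Definition rank_one (x : R) (f : H) : H := rk_ip H f (rk_kx H x) *: rk_kx H x.

Definition loss (q n r : nat) (E : set H) (O : 'I_n -> observable R c q)
    (Y : 'I_n -> 'I_r -> R) (S : 'M[F]_q) : \bar R :=
  (\sum_(i < n) hs_sqnorm E (fun f => \sum_(k < nval (O i))
     (dcoef k S - of_real (freq (Y i) k)) *: rank_one (eigval k) f)%R)%E.

Definition quark_estimator (q n r : nat) (E : set H)
    (O : 'I_n -> observable R c q) (Y : 'I_n -> 'I_r -> R)
    (S : 'M[F]_q) : Prop :=
  [/\ selfadj S, \tr S = 1
    & forall S' : 'M[F]_q, selfadj S' -> \tr S' = 1 ->
        (loss E O Y S <= loss E O Y S')%E].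

End HilbertSchmidt.

(* Main.v *)
From HB Require Import structures.
Require Import Defs.
From mathcomp Require Import all_boot all_order all_algebra.
From mathcomp Require Import all_classical all_reals all_analysis.
From mathcomp Require Import complex ring.

(** Since the operators in the loss have finite rank, Parseval's identity turns
    [Loss_K[S]] into [sum_i (d_i - p_i)^T Omega_i (d_i - p_i)].  Strict positive
    definiteness of [|K|^2] on the distinct eigenvalues of [O_i] makes each
    [Omega_i] positive definite, so [<H_K A, A> = 0] forces all [d_ik[A]] to
    vanish, hence [A = 0] by completeness.  If [H_K S0 = P_K + mu I] and
    [Tr S0 = 1], the cross term of [Loss_K[S0 + D]] is a multiple of [Tr D] for
    every self-adjoint [D]; for [Tr D = 0] this leaves
    [Loss_K[S0 + D] = Loss_K[S0] + n <H_K D, D>], so [S0] is the unique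
    minimizer. *)

Set Implicit Arguments.
Unset Strict Implicit.
Unset Printing Implicit Defensive.
Import Order.TTheory GRing.Theory Num.Theory numFieldNormedType.Exports.
Local Open Scope classical_set_scope.
Local Open Scope ring_scope.

(** * Real and complex scalars treated uniformly *)

Section Scalars.
Context {R : realType} {c : scalar_kind}.
Local Notation F := (scalars R c).
Implicit Types (a b : R) (z w : F).

Lemma of_realK : cancel (@of_real R c) real_part.
Proof. by case: c. Qed.

Lemma real_partD z w : real_part (z + w) = real_part z + real_part w.
Proof. by move: z w; case: c => //= -[? ?] [? ?]. Qed.

Lemma real_part0 : real_part (0 : F) = 0.
Proof. by case: c. Qed.

Lemma real_part_sum (I : Type) (s : seq I) (P : pred I) (f : I -> F) :
  real_part (\sum_(i <- s | P i) f i) = \sum_(i <- s | P i) real_part (f i).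
Proof. exact: (big_morph _ real_partD real_part0). Qed.

Lemma real_partB z w : real_part (z - w) = real_part z - real_part w.
Proof. by apply/eqP; rewrite eq_sym subr_eq -real_partD subrK. Qed.

Lemma sconjK : involutive (@sconj R c).
Proof. by case: c => //= -[x y]; rewrite /= opprK. Qed.

Lemma sconj_of_real a : sconj (of_real a) = of_real a :> F.
Proof. by case: c => //=; rewrite oppr0. Qed.

Lemma sconj_fixed z : sconj z = z -> of_real (real_part z) = z.
Proof.
move: z; case: c => //= -[x y] /eqP; rewrite eq_complex /= eqxx /=.
by rewrite eqNr => /eqP->.
Qed.

Lemma normSE z : `|z| ^+ 2 = z * sconj z.
Proof.
move: z; case: c => [x|x] /=; first by rewrite real_normK ?num_real.
exact: sqr_normc.
Qed.

Lemma ge0_of_real z : 0 <= z -> of_real (real_part z) = z.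
Proof.
by move: z; case: c => //= -[x y]; rewrite lecE /= => /andP[/eqP-> _].
Qed.

Lemma ler_of_real a b : (of_real a <= of_real b :> F) = (a <= b).
Proof. by case: c => //=; rewrite lecR. Qed.

Lemma ltr_of_real a b : (of_real a < of_real b :> F) = (a < b).
Proof. by case: c => //=; rewrite ltcR. Qed.

Lemma norm_real_part z : of_real `|real_part z| <= `|z|.
Proof.
move: z; case: c => //= z.
by rewrite (le_trans _ (normc_ge_Re z)).
Qed.

Lemma sqnormE z : of_real (sqnorm z) = z * sconj z.
Proof. by rewrite /sqnorm ge0_of_real ?exprn_ge0 ?normr_ge0// normSE. Qed.

End Scalars.

(** * Self-adjoint matrices and inversion of superoperators *)

Section Adjoint.
Context {R : realType} {c : scalar_kind}.
Local Notation F := (scalars R c).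

Lemma adjmxD m p (A B : 'M[F]_(m, p)) : adjmx (A + B) = adjmx A + adjmx B.
Proof. by rewrite /adjmx raddfD /= map_mxD. Qed.

Lemma adjmxZ m p a (A : 'M[F]_(m, p)) : adjmx (a *: A) = sconj a *: adjmx A.
Proof. by apply/matrixP => i j; rewrite !mxE rmorphM. Qed.

Lemma adjmx_sum m p (I : Type) (s : seq I) (P : pred I)
    (f : I -> 'M[F]_(m, p)) :
  adjmx (\sum_(i <- s | P i) f i) = \sum_(i <- s | P i) adjmx (f i).
Proof.
by apply: big_morph => [A B|]; rewrite ?adjmxD// /adjmx trmx0 map_mx0.
Qed.

Lemma adjmxM m p s (A : 'M[F]_(m, p)) (B : 'M[F]_(p, s)) :
  adjmx (A *m B) = adjmx B *m adjmx A.
Proof. by rewrite /adjmx trmx_mul map_mxM. Qed.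

Lemma adjmxK m p : cancel (@adjmx R c m p) (@adjmx R c p m).
Proof. by move=> A; apply/matrixP => i j; rewrite !mxE sconjK. Qed.

Lemma mxtrace_adj m (A : 'M[F]_m) : \tr (adjmx A) = sconj (\tr A).
Proof. by rewrite /adjmx trace_map_mx mxtrace_tr. Qed.

Lemma selfadj_addZ m a (A B : 'M[F]_m) :
  selfadj A -> selfadj B -> selfadj (A + of_real a *: B).
Proof.
by rewrite /selfadj /= => As Bs; rewrite adjmxD adjmxZ sconj_of_real As Bs.
Qed.

Lemma selfadj1 m : selfadj (1%:M : 'M[F]_m).
Proof. by rewrite /selfadj /= /adjmx trmx1 map_mx1. Qed.

Lemma selfadjB m (A B : 'M[F]_m) : selfadj A -> selfadj B -> selfadj (A - B).
Proof.
move=> As Bs; rewrite -[B]scale1r -scaleNr.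
by rewrite -[- 1](rmorphN1 (@of_real R c)); exact: selfadj_addZ.
Qed.

Lemma mxtrace_selfadjM m (A B : 'M[F]_m) : selfadj A -> selfadj B ->
  of_real (real_part (\tr (A *m B))) = \tr (A *m B).
Proof.
move=> As Bs; apply: sconj_fixed.
by rewrite -mxtrace_adj adjmxM As Bs mxtrace_mulC.
Qed.

Lemma frobenius_selfadj m (A B : 'M[F]_m) : selfadj B ->
  frobenius A B = real_part (\tr (A *m B)).
Proof. by rewrite /frobenius => ->. Qed.

(** Injectivity makes the square matrix [lin_mx f] row-free, hence invertible. *)
Lemma linear_inj_surj m (f : {linear 'M[F]_m -> 'M[F]_m}) :
  (forall A, f A = 0 -> A = 0) -> forall B, exists A, f A = B.
Proof.
move=> f0 B; have fU : lin_mx f \in unitmx.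
  rewrite -row_free_unit -kermx_eq0; apply/eqP/row_matrixP => i.
  rewrite row0 -[LHS]vec_mxK; apply/eqP; rewrite mxvec_eq0; apply/eqP/f0.
  have := row_sub i (kermx (lin_mx f)).
  by move=> /sub_kermxP; rewrite mul_rV_lin => /eqP; rewrite mxvec_eq0 => /eqP.
exists (vec_mx (mxvec B *m invmx (lin_mx f))).
by apply: (can_inj mxvecK); rewrite -mul_vec_lin vec_mxK mulmxKV.
Qed.

(** Over the complex numbers [u] is the imaginary unit; multiplication by [u] exchanges self-adjoint
    and skew-adjoint matrices. *)
Lemma sconj_trivial_or_skew :
  (@sconj R c =1 id) \/ exists2 u : F, u != 0 & sconj u = - u.
Proof.
case: c; [by left | right].
exists ('i%C : R[i]); last by rewrite /= -{1}oppr0.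
by rewrite eq_complex /= oner_eq0 andbF.
Qed.

(* Over the reals [f] may vanish on skew-symmetric matrices, but the map
   [A |-> f (A + A^T) + (A - A^T)] is injective on all matrices.
   Over the complex numbers a matrix is [B + iC] with [B] and [C] self-adjoint,
   so that [f] is already injective. *)
Lemma selfadj_inj_surj m (f : {linear 'M[F]_m -> 'M[F]_m}) :
  (forall A, f (adjmx A) = adjmx (f A)) ->
  (forall A, selfadj A -> f A = 0 -> A = 0) ->
  forall B, selfadj B -> exists2 A, selfadj A & f A = B.
Proof.
move=> fadj f0.
have f_half A : f A = 0 -> A + adjmx A = 0.
  move=> fA; apply: f0; first by rewrite /selfadj /= adjmxD adjmxK addrC.
  by rewrite linearD /= fadj fA /adjmx trmx0 map_mx0 addr0.
case: sconj_trivial_or_skew => [sconj1 | [u u0 uN]] B Bs.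
  have adjT (A : 'M[F]_m) : adjmx A = A^T.
    by apply/matrixP => i j; rewrite !mxE sconj1.
  pose h : {linear 'M[F]_m -> 'M[F]_m} := idfun \+ trmx.
  pose k : {linear 'M[F]_m -> 'M[F]_m} := idfun \- trmx.
  pose g : {linear 'M[F]_m -> 'M[F]_m} := (f \o h) \+ k.
  have gE A : g A = f (A + A^T) + (A - A^T) by [].
  have gT A : (g A)^T = f (A + A^T) - (A - A^T).
    have trD := raddfD (@trmx F m m); have trB := raddfB (@trmx F m m).
    rewrite /= in trD trB.
    rewrite gE trD trB trmxK -[in LHS]adjT -fadj adjT trD trmxK.
    by rewrite [A^T + _]addrC opprB.
  (* Since [f] commutes with transposition, [A - A^T] is the skew part of [g A]. *)
  have split_sym A : (g A)^T = g A -> A - A^T = 0.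
    rewrite gT gE => /addrI/esym/eqP.
    by rewrite -addr_eq0 -mulr2n -scaler_nat scaler_eq0 pnatr_eq0 => /eqP.
  have /linear_inj_surj/(_ B)[A gA] : forall A, g A = 0 -> A = 0.
    move=> A gA; have skewA : A - A^T = 0 by apply: split_sym; rewrite gA trmx0.
    have : A + A^T = 0.
      apply: f0; last by rewrite -[RHS]gA gE skewA addr0.
      by rewrite /selfadj /= adjT linearD /= trmxK addrC.
    move/eqP: skewA; rewrite subr_eq0 => /eqP <- /eqP.
    by rewrite -mulr2n -scaler_nat scaler_eq0 pnatr_eq0 => /eqP.
  exists (A + A^T); first by rewrite /selfadj /= adjT linearD /= trmxK addrC.
  by rewrite -gA gE split_sym ?addr0// gA -adjT.
(* [f_half] at [A] gives [A + adjmx A = 0]; at [u *: A] it gives [A - adjmx A = 0], because [u] is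
   skew. *)
have /linear_inj_surj/(_ B)[A fA] : forall A, f A = 0 -> A = 0.
  move=> A fA; have := f_half (u *: A).
  rewrite linearZ /= fA scaler0 => /(_ erefl).
  rewrite adjmxZ uN scaleNr -scalerBr => /eqP; rewrite scaler_eq0 (negPf u0) /=.
  rewrite subr_eq0 => /eqP; have := f_half _ fA => /[swap] <- /eqP.
  by rewrite -mulr2n -scaler_nat scaler_eq0 pnatr_eq0 => /eqP.
exists A => //; apply/eqP; rewrite -subr_eq0; apply/eqP.
(* The preimage is self-adjoint: [u] times its skew-adjoint defect is self-adjoint, and [f] kills it
   because [B] is self-adjoint. *)
have : u *: (adjmx A - A) = 0.
  apply: f0; last by rewrite linearZ linearB /= fadj fA Bs subrr scaler0.
  rewrite /selfadj /= -[- A]scaleN1r adjmxZ adjmxD adjmxZ adjmxK.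
  by rewrite uN rmorphN1 !scaleN1r scaleNr -scalerN opprB.
by move/eqP; rewrite scaler_eq0 (negPf u0) => /eqP.
Qed.

(** [superop_inv] chooses preimages among self-adjoint matrices, so surjectivity there makes it a
    right inverse. *)
Lemma superop_invP m (f : 'M[F]_m -> 'M[F]_m) (B : 'M[F]_m) :
  (forall C, selfadj C -> exists2 A, selfadj A & f A = C) -> selfadj B ->
  selfadj (superop_inv f B) /\ f (superop_inv f B) = B.
Proof.
move=> fs Bs; have fsurj : set_surj (@selfadj R c m) (@selfadj R c m) f.
  by move=> C /fs[A As <-]; exists A.
split; first by apply: (surjpinv_image_sub fsurj); exists B.
by rewrite /superop_inv pinvK// inE; exact: fsurj.
Qed.

End Adjoint.

(** * Bilinear forms of kernel Gram matrices *)

Section KernelForm.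
Context {R : realType} (L : R -> R -> R).

(** The form [a^T Omega b], with [Omega] the Gram matrix of [L] at the points [x]. *)
Definition kform m (x a b : 'I_m -> R) : R :=
  \sum_k \sum_l L (x k) (x l) * (a k * b l).

Lemma kformC m (x a b : 'I_m -> R) : (forall s t, L s t = L t s) ->
  kform x a b = kform x b a.
Proof.
move=> LC; rewrite /kform exchange_big /=.
by apply: eq_bigr => k _; apply: eq_bigr => l _; rewrite LC [b k * _]mulrC.
Qed.

Lemma kformDl m (x a a' b : 'I_m -> R) :
  kform x (a \+ a') b = kform x a b + kform x a' b.
Proof.
rewrite /kform -big_split; apply: eq_bigr => k _; rewrite -big_split.
by apply: eq_bigr => l _; rewrite /= mulrDl mulrDr.
Qed.

Lemma kformBl m (x a a' b : 'I_m -> R) :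
  kform x (a \- a') b = kform x a b - kform x a' b.
Proof.
rewrite /kform -sumrB; apply: eq_bigr => k _; rewrite -sumrB.
by apply: eq_bigr => l _; rewrite /= mulrBl mulrBr.
Qed.

Lemma kform_sqrD m (x a b : 'I_m -> R) : (forall s t, L s t = L t s) ->
  kform x (a \+ b) (a \+ b) = kform x a a + kform x a b *+ 2 + kform x b b.
Proof.
move=> LC; rewrite kformDl ![kform x _ (a \+ b)]kformC// !kformDl.
by rewrite [kform x b a]kformC// mulr2n !addrA.
Qed.

Lemma kform_gt0 m (x a : 'I_m -> R) :
  strictly_positive_definite_kernel L -> injective x ->
  (exists k, a k != 0) -> 0 < kform x a a.
Proof.
move=> Lpd xinj [k0 ak0]; have [_ /(_ (\col_k a k))] := Lpd _ _ xinj.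
have [/colP/(_ k0)|_ /(_ isT)] := eqVneq (\col_k a k) 0.
  by rewrite !mxE => a0; rewrite a0 eqxx in ak0.
congr (0 < _); rewrite mxE /kform exchange_big /=; apply: eq_bigr => l _.
rewrite !mxE mulr_suml; apply: eq_bigr => k _; rewrite !mxE; ring.
Qed.

Lemma kform_ge0 m (x a : 'I_m -> R) :
  strictly_positive_definite_kernel L -> injective x -> 0 <= kform x a a.
Proof.
move=> Lpd xinj; have [/existsP a0|] := boolP [exists k, a k != 0].
  exact/ltW/kform_gt0.
rewrite negb_exists => /forallP a0; rewrite /kform.
rewrite big1// => k _; rewrite big1// => l _.
by have := a0 k; rewrite negbK => /eqP->; rewrite mul0r mulr0.
Qed.

End KernelForm.

(** * The kernel Gram superoperator and its strict positivity *)

Section Gram.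
Context {R : realType} {c : scalar_kind} {q n r : nat}.
Local Notation F := (scalars R c).
Variables (K : R -> R -> F) (O : 'I_n -> observable R c q).
Implicit Types (A B S D : 'M[F]_q).

(** For self-adjoint [S] the trace [dcoef k S] is real; taking it in [R] lets the real forms [kform]
    serve both scalar fields. *)
Definition rcoef (Ob : observable R c q) S (k : 'I_(nval Ob)) : R :=
  real_part (dcoef k S).

Lemma rcoefK (Ob : observable R c q) S k :
  selfadj S -> of_real (rcoef (Ob := Ob) S k) = dcoef k S.
Proof. by move=> Ss; rewrite mxtrace_selfadjM//; exact: eigproj_selfadj. Qed.

Lemma rcoefD (Ob : observable R c q) S D :
  rcoef (Ob := Ob) (S + D) =1 rcoef S \+ rcoef D.
Proof. by move=> k; rewrite /rcoef /dcoef mulmxDl linearD /= real_partD. Qed.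

(** The Gram matrix at the two points [s], [t] is self-adjoint, so [K] is Hermitian. *)
Lemma sqkernelC : reproducing_kernel K ->
  forall s t, sqkernel K s t = sqkernel K t s.
Proof.
move=> Kr s t; suff Kst : K s t = sconj (K t s).
  apply: (can_inj (@of_realK R c)).
  by rewrite /sqkernel !sqnormE Kst sconjK mulrC.
pose x (i : 'I_2) := if i == 0 then s else t.
have [/matrixP/(_ 0 1)] := Kr _ x.
by rewrite !mxE /= => /esym.
Qed.

(** Linearity over [F] on all matrices is what the inversion through [lin_mx] works with. *)
Lemma kernel_gram_is_linear (a : F) A B :
  kernel_gram K O (a *: A + B) = a *: kernel_gram K O A + kernel_gram K O B.
Proof.
rewrite /kernel_gram scalerA mulrC -scalerA -scalerDr.
congr (_ *: _); rewrite scaler_sumr -big_split; apply: eq_bigr => i _.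
rewrite scaler_sumr -big_split; apply: eq_bigr => k _.
rewrite scaler_sumr -big_split; apply: eq_bigr => l _ /=.
rewrite scalerA -scalerDl; congr (_ *: _).
rewrite mulmxDl -scalemxAl mxtraceD mxtraceZ mulrDr; congr (_ + _).
by rewrite mulrCA.
Qed.

HB.instance Definition _ :=
  GRing.isLinear.Build F 'M[F]_q 'M[F]_q _ (kernel_gram K O)
    kernel_gram_is_linear.

Lemma kernel_gram_adj A : kernel_gram K O (adjmx A) = adjmx (kernel_gram K O A).
Proof.
rewrite /kernel_gram adjmxZ adjmx_sum fmorphV rmorph_nat.
congr (_ *: _); apply: eq_bigr => i _; rewrite adjmx_sum.
apply: eq_bigr => k _; rewrite adjmx_sum; apply: eq_bigr => l _.
rewrite adjmxZ eigproj_selfadj rmorphM /= sconj_of_real -mxtrace_adj adjmxM.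
by rewrite eigproj_selfadj mxtrace_mulC.
Qed.

(** Transfers symmetry and positivity from the real forms [kform] to the superoperator. *)
Lemma kernel_gram_form A B : selfadj A -> selfadj B ->
  \tr (kernel_gram K O A *m B) =
  of_real (n%:R^-1 *
    \sum_(i < n) kform (sqkernel K) (@eigval _ _ _ (O i)) (rcoef A) (rcoef B)).
Proof.
move=> As Bs; rewrite /kernel_gram -scalemxAl mxtraceZ rmorphM /= fmorphV.
rewrite rmorph_nat; congr (_ * _); rewrite mulmx_suml !raddf_sum /=.
apply: eq_bigr => i _; rewrite mulmx_suml !raddf_sum.
apply: eq_bigr => k _; rewrite mulmx_suml !raddf_sum.
apply: eq_bigr => l _; rewrite -scalemxAl /= mxtraceZ !rmorphM /=.
by rewrite !rcoefK// /dcoef [\tr (eigproj l *m _)]mxtrace_mulC mulrA.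
Qed.

(** Together with [kernel_gram_form], expresses the cross term of the loss through traces. *)
Lemma effective_data_form (Y : 'I_n -> 'I_r -> R) B : selfadj B ->
  \tr (effective_data K O Y *m B) =
  of_real (n%:R^-1 *
    \sum_(i < n) kform (sqkernel K) (@eigval _ _ _ (O i))
      (freq (Y i)) (rcoef B)).
Proof.
move=> Bs; rewrite /effective_data -scalemxAl mxtraceZ rmorphM /= fmorphV.
rewrite rmorph_nat; congr (_ * _); rewrite mulmx_suml !raddf_sum /=.
apply: eq_bigr => i _; rewrite mulmx_suml !raddf_sum.
apply: eq_bigr => k _; rewrite mulmx_suml !raddf_sum.
apply: eq_bigr => l _; rewrite -scalemxAl /= mxtraceZ rmorphM [RHS]rmorphM /=.
rewrite [of_real (freq _ _ * _)]rmorphM rcoefK// /dcoef.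
by rewrite [\tr (eigproj l *m _)]mxtrace_mulC mulrA.
Qed.

Lemma selfadj_effective_data (Y : 'I_n -> 'I_r -> R) :
  selfadj (effective_data K O Y).
Proof.
rewrite /selfadj /= /effective_data adjmxZ adjmx_sum fmorphV rmorph_nat.
congr (_ *: _); apply: eq_bigr => i _; rewrite adjmx_sum.
apply: eq_bigr => k _; rewrite adjmx_sum; apply: eq_bigr => l _.
by rewrite adjmxZ eigproj_selfadj sconj_of_real.
Qed.

(** With no observables all coefficients vanish trivially, yet for [q >= 2] the traceless matrix
    [E_00 - E_11] is nonzero. *)
Lemma complete_design_gt0 : (2 <= q)%N -> complete_design O -> (0 < n)%N.
Proof.
case: q O => [|[|p]]// O' _ Oc; rewrite lt0n; apply/eqP => n0.
pose D : 'M[F]_p.+2 := delta_mx 0 0 - delta_mx 1 1.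
have Ds : selfadj D.
  apply: selfadjB; rewrite /selfadj /= /adjmx trmx_delta; exact: map_delta_mx.
have trD : \tr D = 0.
  have tr1 i : \tr (delta_mx i i : 'M[F]_p.+2) = 1.
    rewrite /mxtrace (bigD1 i) //= mxE !eqxx big1 ?addr0// => j /negPf ji.
    by rewrite mxE ji.
  by rewrite linearB /= !tr1 subrr.
have /(Oc _ Ds trD)/matrixP/(_ 0 0) : forall i k, dcoef (A := O' i) k D = 0.
  by move=> i; have := ltn_ord i; rewrite {2}n0.
by rewrite !mxE /= subr0 => /eqP; rewrite oner_eq0.
Qed.

Hypotheses (q2 : (2 <= q)%N) (Oc : complete_design O)
  (Kr : reproducing_kernel K)
  (K2 : strictly_positive_definite_kernel (sqkernel K)).

(** The projections of one observable sum to the identity, so vanishing coefficients already force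
    [\tr D = 0]. *)
Lemma complete_design_eq0 D : selfadj D ->
  (forall i (k : 'I_(nval (O i))), dcoef k D = 0) -> D = 0.
Proof.
move=> Ds D0; have n0 := complete_design_gt0 q2 Oc.
apply/(Oc Ds) => //; rewrite -[D]mulmx1 -(eigproj_sum (O (Ordinal n0))).
by rewrite mulmx_sumr raddf_sum big1// => k _; exact: D0.
Qed.

Lemma kernel_gram_gt0 A : selfadj A -> A != 0 ->
  0 < frobenius (kernel_gram K O A) A.
Proof.
move=> As A0; rewrite frobenius_selfadj// kernel_gram_form// of_realK.
rewrite mulr_gt0 ?invr_gt0 ?ltr0n ?complete_design_gt0//.
(* Either some observable sees [A] and contributes a positive term, or completeness gives
   [A = 0]. *)
have [/existsP[i /existsP a0]|] :=
    boolP [exists i, [exists k, rcoef (Ob := O i) A k != 0]].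
  rewrite (bigD1 i) //= ltr_pwDl ?sumr_ge0//.
    by apply: kform_gt0 => //; exact: eigval_inj.
  by move=> j _; apply: kform_ge0 => //; exact: eigval_inj.
move=> /existsPn a0; case/eqP: A0; apply: complete_design_eq0 => // i k.
have /existsPn/(_ k) := a0 i; rewrite negbK -rcoefK// => /eqP->.
exact: rmorph0.
Qed.

Lemma kernel_gram_strictly_positive :
  strictly_positive_superoperator (kernel_gram K O).
Proof.
split; last exact: kernel_gram_gt0.
  split=> [A As|a A B _ _]; last by rewrite linearP.
  by rewrite /selfadj /= -kernel_gram_adj As.
move=> A B As Bs; have Ts : selfadj (kernel_gram K O B).
  by rewrite /selfadj /= -kernel_gram_adj Bs.
rewrite !frobenius_selfadj// [in RHS]mxtrace_mulC !kernel_gram_form//.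
congr (real_part (of_real (_ * _))); apply: eq_bigr => i _.
exact/kformC/sqkernelC.
Qed.

(** Strict positivity leaves only 0 in the kernel among self-adjoint matrices. *)
Lemma kernel_gram_surj B : selfadj B ->
  exists2 A, selfadj A & kernel_gram K O A = B.
Proof.
apply: selfadj_inj_surj => [A|A As TA]; first exact: kernel_gram_adj.
apply/eqP/negPn/negP => /(kernel_gram_gt0 As).
by rewrite TA /frobenius mul0mx mxtrace0 real_part0 ltxx.
Qed.

End Gram.

(** * Orthogonal projections in the reproducing kernel Hilbert space *)

Section InnerProduct.
Context {R : realType} {c : scalar_kind} {K : R -> R -> scalars R c}.
Local Notation F := (scalars R c).
Variable H : rkhs K.
Local Notation ip := (rk_ip H).
Implicit Types (f g h u w : H) (s : seq H) (E : set H).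

Lemma ipC f g : ip f g = sconj (ip g f).
Proof. by rewrite [LHS]hermitian_subproof expr0 mul1r. Qed.

Lemma ipDl f g h : ip (f + g) h = ip f h + ip g h.
Proof. exact: linearDl. Qed.

Lemma ipBl f g h : ip (f - g) h = ip f h - ip g h.
Proof. exact: linearBl. Qed.

Lemma ipZl (a : F) f g : ip (a *: f) g = a * ip f g.
Proof. exact: linearZl_LR. Qed.

Lemma ip_suml (I : Type) (t : seq I) (P : pred I) (G : I -> H) g :
  ip (\sum_(i <- t | P i) G i) g = \sum_(i <- t | P i) ip (G i) g.
Proof. exact: linear_sumlz. Qed.

Lemma ipDr f g h : ip f (g + h) = ip f g + ip f h.
Proof. by rewrite ipC ipDl rmorphD -!ipC. Qed.

Lemma ipBr f g h : ip f (g - h) = ip f g - ip f h.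
Proof. by rewrite ipC ipBl rmorphB -!ipC. Qed.

Lemma ipZr (a : F) f g : ip f (a *: g) = sconj a * ip f g.
Proof. by rewrite ipC ipZl rmorphM -ipC. Qed.

Lemma ip_sumr (I : Type) (t : seq I) (P : pred I) (G : I -> H) g :
  ip g (\sum_(i <- t | P i) G i) = \sum_(i <- t | P i) ip g (G i).
Proof.
by rewrite ipC ip_suml rmorph_sum; apply: eq_bigr => i _; rewrite -ipC.
Qed.

Lemma rk_pythagoras u w : ip u w = 0 -> `|u| <= `|u + w|.
Proof.
move=> uw; rewrite -(@ler_pXn2r _ 2) ?nnegrE// !rk_norm ipDl !ipDr.
by rewrite uw [ip w u]ipC uw rmorph0 addr0 add0r lerDl -rk_norm exprn_ge0.
Qed.

Lemma rk_cauchy_schwarz f g : `|ip f g| <= `|f| * `|g|.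
Proof.
have [->|g0] := eqVneq g 0.
  by rewrite ipC -(scale0r 0) ipZl mul0r rmorph0 normr0 mulr_ge0.
have gg : 0 < `|g| ^+ 2 by rewrite exprn_gt0 ?normr_gt0.
(* [a *: g] is the orthogonal projection of [f] on the line of [g], so it is no longer than [f]. *)
pose a := ip f g / `|g| ^+ 2.
have fg : ip (f - a *: g) (a *: g) = 0.
  by rewrite ipZr ipBl ipZl -rk_norm /a divfK ?gt_eqF// subrr mulr0.
have /rk_pythagoras : ip (a *: g) (f - a *: g) = 0 by rewrite ipC fg rmorph0.
rewrite addrC subrK normrZ normrM normfV normrX normr_id.
rewrite expr2 invfM -!mulrA mulVf ?normr_eq0// mulr1.
by rewrite ler_pdivrMr ?normr_gt0.
Qed.

(** The orthogonal projection of [g] on the span of [s], when [s] lists distinct orthonormal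
    vectors. *)
Definition rk_proj s g : H := \sum_(e <- s) ip g e *: e.

(** The residual [g - rk_proj s g] is orthogonal to the span of [s]; Pythagoras then compares it
    with any other combination. *)
Lemma rk_proj_best E s g m (e : 'I_m -> H) (a : 'I_m -> F) :
  (forall e f, E e -> E f -> ip e f = (e == f)%:R) ->
  uniq s -> {in s, forall e, E e} -> (forall j, e j \in s) ->
  `|g - rk_proj s g| <= `|g - \sum_j a j *: e j|.
Proof.
move=> Eon su sE es; set u := g - _.
have ue f : f \in s -> ip u f = 0.
  move=> fs; rewrite ipBl ip_suml (bigD1_seq f)//= big_seq_cond big1 => [|e'].
    by rewrite ipZl (Eon f f (sE _ fs) (sE _ fs)) eqxx mulr1 addr0 subrr.
  move=> /andP[e's /negPf ef].
  by rewrite ipZl (Eon e' f (sE _ e's) (sE _ fs)) ef mulr0.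
have -> : g - \sum_j a j *: e j = u + (rk_proj s g - \sum_j a j *: e j).
  by rewrite addrA subrK.
apply: rk_pythagoras; rewrite ipBr !ip_sumr big_seq big1 => [|f fs].
  by rewrite big1 ?subrr// => j _; rewrite ipZr ue ?mulr0.
by rewrite ipZr ue ?mulr0.
Qed.

(** Take for [s] the vectors of a combination close to [g]; projecting on a larger list is at least
    as good. This is convergence along finite subsets, as [E] may be uncountable. *)
Lemma rk_proj_dense E g (eps : F) : orthonormal_basis E -> 0 < eps ->
  exists2 s : seq H, {in s, forall e, E e} &
    forall t, uniq t -> {in t, forall e, E e} -> {subset s <= t} ->
      `|g - rk_proj t g| < eps.
Proof.
move=> [Eon Ed] eps0; have : closure (linear_span E) g by rewrite Ed.
move=> /(_ _ (nbhsx_ballx g eps eps0))[h [[m [e [a [eE ->]]]]]].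
rewrite -ball_normE /= => gh.
exists [seq e j | j <- enum 'I_m].
  by move=> f /mapP[j _ ->]; exact: eE.
move=> t tu tE st; apply: le_lt_trans gh; apply: rk_proj_best Eon tu tE _ => j.
by apply: st; rewrite map_f// mem_enum.
Qed.

Lemma rk_proj_dense_fam E m (g : 'I_m -> H) (eps : F) :
  orthonormal_basis E -> 0 < eps ->
  exists2 s : seq H, {in s, forall e, E e} &
    forall t, uniq t -> {in t, forall e, E e} -> {subset s <= t} ->
      forall k, `|g k - rk_proj t (g k)| < eps.
Proof.
move=> Eb eps0.
have /choice[s sP] : forall k, exists s : seq H, {in s, forall e, E e} /\
    forall t, uniq t -> {in t, forall e, E e} -> {subset s <= t} ->
      `|g k - rk_proj t (g k)| < eps.
  by move=> k; have [s sE sP] := rk_proj_dense (g k) Eb eps0; exists s.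
exists (flatten [seq s k | k <- enum 'I_m]).
  by move=> e /flatten_mapP[k _]; apply: (sP k).1.
move=> t tu tE st k; apply: (sP k).2 => // e es.
by apply/st/flatten_mapP; exists k; rewrite ?mem_enum.
Qed.

(** * Hilbert-Schmidt norms of finite-rank operators *)

Section FiniteRank.
Variables (m : nat) (x : 'I_m -> R) (a : 'I_m -> R).
Local Notation kx k := (rk_kx H (x k)).
Local Notation T :=
  (fun f : H => \sum_k of_real (a k) *: rank_one (x k) f).

Lemma ip_kx (s t : R) : ip (rk_kx H s) (rk_kx H t) = K t s.
Proof. by rewrite -rk_reproducing rk_kxE. Qed.

(** The left side is the Hilbert-Schmidt pairing of [k_s k_s^*] and [k_t k_t^*]; this is how [|K|^2]
    enters. *)
Lemma ip_kx_sq (s t : R) :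
  ip (rk_kx H s) (rk_kx H t) * ip (rk_kx H t) (rk_kx H s) =
  of_real (sqkernel K s t).
Proof. by rewrite [ip (rk_kx H s) _]ipC ip_kx sqnormE mulrC. Qed.

Lemma normT f : `|T f| ^+ 2 = \sum_k \sum_l
  of_real (a k * a l) * ip (kx k) (kx l) * (ip (kx l) f * ip f (kx k)).
Proof.
rewrite rk_norm ip_suml; apply: eq_bigr => k _; rewrite ip_sumr.
apply: eq_bigr => l _; rewrite !ipZl !ipZr !sconj_of_real -ipC rmorphM /=.
ring.
Qed.

(** Summing [ip (kx l) e * ip e (kx k)] over [s] gives [ip (rk_proj s (kx l)) (kx k)], so only the
    projection residuals remain. *)
Lemma hs_defect s :
  of_real (kform (sqkernel K) x a a) - \sum_(e <- s) `|T e| ^+ 2 =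
  \sum_k \sum_l of_real (a k * a l) * ip (kx k) (kx l) *
     ip (kx l - rk_proj s (kx l)) (kx k).
Proof.
under [X in _ - X]eq_bigr do rewrite normT.
rewrite exchange_big /kform rmorph_sum -sumrB; apply: eq_bigr => k _ /=.
rewrite exchange_big rmorph_sum -sumrB; apply: eq_bigr => l _ /=.
rewrite -mulr_sumr ipBl ip_suml mulrBr rmorphM -ip_kx_sq; congr (_ - _).
  by rewrite mulrC mulrA.
by congr (_ * _); apply: eq_bigr => e _; rewrite ipZl.
Qed.

(* By [hs_defect] and Cauchy-Schwarz, a finite partial sum over [s] misses the
   value by at most a constant times the distances of the [kx l] to the span of
   [s]. *)
Lemma hs_sqnorm_rank E : orthonormal_basis E ->
  hs_sqnorm E T = (kform (sqkernel K) x a a)%:E.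
Proof.
move=> Eb; set V := kform _ _ _ _.
pose p s := \sum_(e <- s) real_part (`|T e| ^+ 2).
have p_homo s t : uniq s -> uniq t -> {subset s <= t} -> p s <= p t.
  move=> su tu st; rewrite /p [leRHS](bigID (mem s)) /=.
  rewrite -[X in _ <= X + _]big_filter.
  rewrite (perm_big [seq e <- t | e \in s]) ?lerDl ?sumr_ge0//.
    by move=> e _; rewrite -(@ler_of_real R c) rmorph0 ge0_of_real ?exprn_ge0.
  apply: uniq_perm; rewrite ?filter_uniq// => e.
  by rewrite mem_filter andb_idr//; exact: st.
have p_cvg (d : R) : 0 < d -> exists2 s : seq H, {in s, forall e, E e} &
    forall t, uniq t -> {in t, forall e, E e} -> {subset s <= t} ->
      `|V - p t| <= d.
  move=> d0; pose C : F := \sum_k \sum_l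
    `|of_real (a k * a l) * ip (kx k) (kx l)| * `|kx k|.
  have C0 : 0 <= C.
    by do 2!apply: sumr_ge0 => ? _; rewrite mulr_ge0.
  (* The added 1 keeps the denominator positive when [C = 0]. *)
  have dC : 0 < of_real d / (C + 1).
    by rewrite divr_gt0 ?ltr_wpDl// -(rmorph0 of_real) ltr_of_real.
  have [s sE sP] := rk_proj_dense_fam (fun k => kx k) Eb dC.
  exists s => // t tu tE st; rewrite -(@ler_of_real R c).
  have -> : V - p t = real_part (of_real V - \sum_(e <- t) `|T e| ^+ 2).
    by rewrite real_partB of_realK real_part_sum.
  apply: le_trans (norm_real_part _) _; rewrite hs_defect.
  apply: (@le_trans _ _ (C * (of_real d / (C + 1)))).
    rewrite /C mulr_suml; apply: le_trans (ler_norm_sum _ _ _) _.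
    apply: ler_sum => k _; rewrite mulr_suml.
    apply: le_trans (ler_norm_sum _ _ _) _; apply: ler_sum => l _.
    rewrite normrM -mulrA ler_wpM2l//.
    apply: le_trans (rk_cauchy_schwarz _ _) _.
    by rewrite mulrC ler_wpM2l// ltW// sP.
  rewrite mulrCA ler_piMr//.
    by rewrite -(rmorph0 of_real) ler_of_real ltW.
  by rewrite ler_pdivrMr ?ltr_wpDl// mul1r lerDl.
have TE f : (0 <= (real_part (`|T f| ^+ 2))%:E)%E.
  by rewrite lee_fin -(@ler_of_real R c) rmorph0 ge0_of_real ?exprn_ge0.
have esum_p s : uniq s ->
    (\sum_(e \in [set` s]) (real_part (`|T e| ^+ 2))%:E = (p s)%:E)%E.
  by move=> su; rewrite -fsbig_seq// sumEFin.
apply/eqP; rewrite eq_le; apply/andP; split.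
  (* Upper bound: enlarging a finite subset [X] by [s] only increases its sum, which is then at most
     [V + d]. *)
  apply: ge_ereal_sup => _ [X [Xfin XE] <-].
  apply/lee_addgt0Pr => d d0; have [s sE sP] := p_cvg _ d0.
  have /finite_seqP[t0 Xt0] := Xfin.
  have {Xt0}XE0 : X = [set` undup t0].
    by rewrite Xt0; apply/seteqP; split=> e /=; rewrite mem_undup.
  pose t := undup (undup t0 ++ s).
  have tE : {in t, forall e, E e}.
    move=> e; rewrite mem_undup mem_cat => /orP[et|/sE//].
    by apply: XE; rewrite XE0.
  rewrite XE0 esum_p ?undup_uniq// -EFinD lee_fin.
  apply: (@le_trans _ _ (p t)).
    apply: p_homo; rewrite ?undup_uniq// => e et.
    by rewrite mem_undup mem_cat et.
  rewrite -lerBlDl; apply: le_trans (ler_norm _) _; rewrite distrC.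
  by apply: sP => [||e es]; rewrite ?undup_uniq// mem_undup mem_cat es orbT.
(* Lower bound: the finite set [s] alone reaches [V - d]. *)
apply/lee_addgt0Pr => d d0; have [s sE sP] := p_cvg _ d0.
rewrite -leeBlDr// -EFinB; apply: (@le_trans _ _ (p (undup s))%:E).
  rewrite lee_fin lerBlDr -lerBlDl; apply: le_trans (ler_norm _) _.
  by apply: sP => [|e|e]; rewrite ?undup_uniq// mem_undup//; exact: sE.
rewrite -esum_p ?undup_uniq//; apply: ereal_sup_ubound.
exists [set` undup s] => //; split; first exact: finite_seq.
by move=> e /=; rewrite mem_undup; exact: sE.
Qed.

End FiniteRank.
End InnerProduct.

(** * Reduction of the loss and uniqueness of the minimizer *)

Section Minimization.
Context {R : realType} {c : scalar_kind} {q n r : nat}.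
Local Notation F := (scalars R c).
Variables (K : R -> R -> F) (O : 'I_n -> observable R c q)
  (Y : 'I_n -> 'I_r -> R).
Hypotheses (q2 : (2 <= q)%N) (Oc : complete_design O)
  (Kr : reproducing_kernel K)
  (K2 : strictly_positive_definite_kernel (sqkernel K)).
Variables (H : rkhs K) (E : set H) (Eb : orthonormal_basis E).
Implicit Types S D : 'M[F]_q.
Local Notation T := (kernel_gram K O).
Local Notation P := (effective_data K O Y).
Local Notation xi i := (@eigval _ _ _ (O i)).

(** The formula mentions neither [H] nor [E], so the minimizer does not depend on them. *)
Definition sqloss S : R := \sum_(i < n)
  kform (sqkernel K) (xi i) (rcoef S \- freq (Y i)) (rcoef S \- freq (Y i)).

Lemma lossE S : selfadj S -> loss E O Y S = (sqloss S)%:E.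
Proof.
move=> Ss; rewrite /loss /sqloss -sumEFin; apply: eq_bigr => i _.
rewrite -(hs_sqnorm_rank _ _ Eb); congr hs_sqnorm; apply/funext => f.
by apply: eq_bigr => k _; rewrite rmorphB rcoefK.
Qed.

Lemma kform_ext m (x a a' b b' : 'I_m -> R) : a =1 a' -> b =1 b' ->
  kform (sqkernel K) x a b = kform (sqkernel K) x a' b'.
Proof. by move=> /funext-> /funext->. Qed.

Lemma sqlossD S D mu : selfadj S -> selfadj D -> \tr D = 0 ->
  T S = P + mu *: 1%:M ->
  sqloss (S + D) = sqloss S + n%:R * frobenius (T D) D.
Proof.
move=> Ss Ds D0 TS; have n0 : n%:R != 0 :> R.
  by rewrite pnatr_eq0 -lt0n; exact: complete_design_gt0 q2 Oc.
(* Pairing the equation for [T S] with the traceless [D] removes the multiple of the identity. *)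
have cross : \sum_(i < n)
    kform (sqkernel K) (xi i) (rcoef S \- freq (Y i)) (rcoef D) = 0.
  have : \tr (T S *m D) = \tr (P *m D).
    by rewrite TS mulmxDl -scalemxAl mul1mx mxtraceD mxtraceZ D0 mulr0 addr0.
  rewrite kernel_gram_form// effective_data_form//.
  move=> /(can_inj (@of_realK R c))/(mulfI (invr_neq0 n0))/eqP.
  rewrite -subr_eq0 -sumrB => /eqP.
  move=> PTS; rewrite -[RHS]PTS; apply: eq_bigr => i _; exact: kformBl.
rewrite frobenius_selfadj// kernel_gram_form// of_realK mulVKf// /sqloss.
transitivity (\sum_(i < n) (let d := rcoef S \- freq (Y i) in
    kform (sqkernel K) (xi i) d d + kform (sqkernel K) (xi i) d (rcoef D) *+ 2
    + kform (sqkernel K) (xi i) (rcoef D) (rcoef D))).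
  apply: eq_bigr => i _; rewrite /= -(kform_sqrD _ _ _ (sqkernelC Kr)).
  by apply: kform_ext => k; rewrite /= rcoefD /= addrAC.
by rewrite !big_split /= cross !addr0.
Qed.

(** The equation for [T S0] is the Lagrange condition for the trace constraint. A competitor [S]
    exceeds the loss of [S0] by [n] times the form of [T] at [S - S0], which is positive unless
    [S = S0]. *)
Lemma quark_unique S0 mu : selfadj S0 -> \tr S0 = 1 ->
  T S0 = P + mu *: 1%:M ->
  forall S, quark_estimator E O Y S <-> S = S0.
Proof.
move=> S0s S01 TS0 S.
have lossD S' : selfadj S' -> \tr S' = 1 ->
    sqloss S' = sqloss S0 + n%:R * frobenius (T (S' - S0)) (S' - S0).
  move=> S's S'1; have D0 : \tr (S' - S0) = 0.
    by rewrite raddfB /= S'1 S01 subrr.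
  by rewrite -(sqlossD S0s (selfadjB S's S0s) D0 TS0) [S0 + _]addrC subrK.
split=> [[Ss S1 Smin]|->]; last first.
  split=> // S' S's S'1; rewrite !lossE// lee_fin (lossD S')// lerDl mulr_ge0//.
  have [->|S'S] := eqVneq S' S0.
    by rewrite subrr linear0 /frobenius mul0mx mxtrace0 real_part0.
  apply/ltW/kernel_gram_gt0 => //; first exact: selfadjB.
  by rewrite subr_eq0.
apply/eqP/negPn/negP => SS0.
have := Smin _ S0s S01; rewrite !lossE// lee_fin (lossD S)// gerDl leNgt.
rewrite mulr_gt0 ?ltr0n ?(complete_design_gt0 q2 Oc)//.
by apply: kernel_gram_gt0; rewrite ?subr_eq0//; exact: selfadjB.
Qed.

End Minimization.

(** * Closed form of the estimator *)

Theorem theorem4p20 (R : realType) (c : scalar_kind) (q n r : nat)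
    (O : 'I_n -> observable R c q) (Y : 'I_n -> 'I_r -> R)
    (K : R -> R -> scalars R c)
    (hq : (2 <= q)%N) (hr : (0 < r)%N)
    (hO : complete_design O)
    (hY : forall i, outcomes_of (O i) (Y i))
    (hK : reproducing_kernel K)
    (hK2 : strictly_positive_definite_kernel (sqkernel K)) :
  strictly_positive_superoperator (kernel_gram K O) /\
  forall (H : rkhs K) (E : set H), orthonormal_basis E ->
  forall S : 'M[scalars R c]_q,
    quark_estimator E O Y S <->
    S = let Hinv := superop_inv (kernel_gram K O) in
        let P := effective_data K O Y in
        Hinv P + ((1 - \tr (Hinv P)) / \tr (Hinv 1%:M)) *: Hinv 1%:M.
Proof.
split=> [|H E Eb S]; first exact: kernel_gram_strictly_positive.
have Tinv := superop_invP (kernel_gram_surj hq hO hK2).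
set T := kernel_gram K O; set Hinv := superop_inv T.
set P := effective_data K O Y; cbv zeta.
have [As TA] := Tinv _ (selfadj_effective_data K O Y : selfadj P).
have [Js TJ] := Tinv _ (selfadj1 (R := R) (c := c) q).
rewrite -/Hinv in As TA Js TJ.
(* With [J = Hinv 1%:M], the trace of [J] is the form of [T] at [J], which is positive since [J] is
   nonzero. *)
have trJ : \tr (Hinv 1%:M) != 0.
  have := kernel_gram_gt0 hq hO hK2 Js; rewrite TJ frobenius_selfadj// mul1mx.
  have J0 : Hinv 1%:M != 0.
    apply/eqP => J0; move: TJ; rewrite J0 linear0.
    move=> /matrixP/(_ (Ordinal (ltnW hq)) (Ordinal (ltnW hq)))/eqP.
    by rewrite !mxE eqxx eq_sym oner_eq0.
  move=> /(_ J0); apply: contraTneq => ->.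
  by rewrite real_part0 ltxx.
(* [mu] normalizes the trace to 1; it is real, as a quotient of traces of self-adjoint matrices, so
   the candidate stays self-adjoint. *)
set mu := _ / _.
have mu_real : of_real (real_part mu) = mu.
  by apply: sconj_fixed; rewrite fmorph_div rmorphB rmorph1 -!mxtrace_adj As Js.
apply: (@quark_unique _ _ _ _ _ K O Y hq hO hK hK2 H E Eb _ mu).
- by rewrite -mu_real; exact: selfadj_addZ.
- by rewrite mxtraceD mxtraceZ divfK// addrC subrK.
by rewrite addrC [LHS]linearP /= TA TJ addrC.
Qed.
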